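(* Let $M$ be a complex manifold and let $(\|\cdot\|_r)_{r\in(0,1)}$ be a one-parameter family of continuous semi-norms on $\mathcal{H}(M)$ satisfying conditions a)–d) of the context, with $z_0\in M$ the point appearing in c) and d). Let $\beta$ denote the common value $B(\|\cdot\|_r,\Pi)=B(\|\cdot\|_r,U)$, where $U\subset\mathbf{C}$ is any disk and $\Pi\subset\mathbf{C}$ is any half-plane. Let $G\subset\mathbf{C}$ be a domain with convex hull $\tilde G$. If $\tilde G\neq\mathbf{C}$, then $B(\|\cdot\|_r,G)$ is not smaller than $\beta$: $$B(\|\cdot\|_r,G)\geq\beta .$$ If $\partial G$ contains at least one regular point of convexity, then $$B(\|\cdot\|_r,G)=\beta .$$
   Context: $\mathcal{H}(M)$ is the space of holomorphic functions on $M$ with the topology of uniform convergence on compact subsets of $M$. The semi-norms $\|\cdot\|_r$, $r\in(0,1)$, on $\mathcal{H}(M)$ are continuous with respect to this topology and satisfy: a) $\|\cdot\|_{r_1}\leq\|\cdot\|_{r_2}$ if $r_1\leq r_2$; b) $\|f\cdot g\|_r\leq\|f\|_r\cdot\|g\|_r$ for all $f,g\in\mathcal{H}(M)$ and all $r\in(0,1)$; and there exists a point $z_0\in M$ such that c) $\|f\|_r\to|f(z_0)|$ as $r\to0$, for all $f\in\mathcal{H}(M)$; d) $\|f\|_r=|f(z_0)|+\|f-f(z_0)\|_r$ for all $f\in\mathcal{H}(M)$ (here $f(z_0)$ also denotes the constant function with this value). For a domain $G\subset\mathbf{C}$ with convex hull $\tilde G$, $B(\|\cdot\|_r,G)$ denotes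 the largest $r\geq0$ such that for every $f\in\mathcal{H}(M)$ with $f(M)\subset G$ one has $$\|f-f(z_0)\|_r<\mathrm{dist}(f(z_0),\partial\tilde G).$$ ($B$ depends on the whole family of semi-norms; the $r$ in the notation $B(\|\cdot\|_r,G)$ is a dummy index.) A point $p\in\partial G$ is called a point of convexity if $p\in\partial\tilde G$. A point of convexity $p$ is called regular if there exists a disk $U\subset G$ such that $p\in\partial U$. *)

(* Defs.v *)
From HB Require Import structures.
From mathcomp Require Import all_boot all_order all_algebra.
From mathcomp Require Import complex.
From mathcomp Require Import all_classical all_reals all_analysis.
Import Order.TTheory GRing.Theory Num.Theory.
Import numFieldNormedType.Exports.

Set Implicit Arguments.
Unset Strict Implicit.
Unset Printing Implicit Defensive.

Local Open Scope classical_set_scope.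
Local Open Scope ring_scope.

(* [C R] carries the topology and the normed C-module structure of the complex
   plane; its norm `|z| is C-valued, hence the use of the real-valued modulus
   [cmod] wherever a real number is needed. *)
Notation C R := (R[i]^o)%type.
Notation cmod := ComplexField.Normc.normc.

(* [differentiable] is Frechet differentiability of a map between normed
   modules over R[i], so the differential is C-linear. *)
Definition holomorphic_on (R : realType) (n : nat)
    (W : normedModType R[i]) (D : set 'rV[C R]_n) (f : 'rV[C R]_n -> W) : Prop :=
  forall x, D x -> differentiable f x.

(* The two maps are total functions; only their values on [chart_dom] and on
   its image are meaningful. *)
Record chart (R : realType) (M : topologicalType) (n : nat) := Chart {
  chart_dom : set M;
  chart_map : M -> 'rV[C R]_n;
  chart_inv : 'rV[C R]_n -> M
}.

Definition chart_cod (R : realType) (M : topologicalType) (n : nat)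
    (c : chart R M n) : set 'rV[C R]_n := chart_map c @` chart_dom c.

Record is_chart (R : realType) (M : topologicalType) (n : nat)
    (c : chart R M n) : Prop := IsChart {
  chart_dom_open : open (chart_dom c);
  chart_cod_open : open (chart_cod c);
  chart_mapK : forall x, chart_dom c x -> chart_inv c (chart_map c x) = x;
  chart_map_continuous : {within chart_dom c, continuous (chart_map c)};
  chart_inv_continuous : {within chart_cod c, continuous (chart_inv c)}
}.

Record complexManifold (R : realType) (n : nat) := ComplexManifold {
  manifold_space :> topologicalType;
  manifold_hausdorff : hausdorff_space manifold_space;
  manifold_second_countable : @second_countable manifold_space;
  atlas : set (chart R manifold_space n);
  atlas_charts : forall c, atlas c -> is_chart c;
  atlas_cover : forall x, exists2 c, atlas c & chart_dom c x;
  atlas_transition : forall c c', atlas c -> atlas c' ->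
    holomorphic_on (chart_map c @` (chart_dom c `&` chart_dom c'))
                   (chart_map c' \o chart_inv c)
}.

Definition holomorphic (R : realType) (n : nat) (M : complexManifold R n) :
    set (M -> C R) :=
  [set f : M -> C R | forall c, atlas c ->
    holomorphic_on (chart_cod c) (f \o chart_inv c)].

(* A functional is defined on all functions, but nothing is required of its
   values outside H(M). *)
Record is_seminorm (R : realType) (n : nat) (M : complexManifold R n)
    (p : (M -> C R) -> R) : Prop := IsSeminorm {
  seminorm_ge0 : forall f, holomorphic f -> 0 <= p f;
  seminorm_triangle : forall f g, holomorphic f -> holomorphic g ->
    p (fun z => f z + g z) <= p f + p g;
  seminorm_scale : forall (a : C R) f, holomorphic f ->
    p (fun z => a * f z) = cmod a * p f
}.

(* H(M) has the topology induced by uniform convergence on compact sets. *)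
Definition seminorm_continuous (R : realType) (n : nat)
    (M : complexManifold R n) (p : (M -> C R) -> R) : Prop :=
  {within (@holomorphic R n M : set {family compact, M -> C R}),
    continuous (p : {family compact, M -> C R} -> R)}.

Record bohr_family (R : realType) (n : nat) (M : complexManifold R n)
    (z0 : M) (N : R -> (M -> C R) -> R) : Prop := BohrFamily {
  family_seminorm : forall r, 0 < r < 1 -> is_seminorm (N r);
  family_continuous : forall r, 0 < r < 1 -> seminorm_continuous (N r);
  family_mono : forall r1 r2 f, 0 < r1 < 1 -> 0 < r2 < 1 -> r1 <= r2 ->
    holomorphic f -> N r1 f <= N r2 f;
  family_submul : forall r f g, 0 < r < 1 ->
    holomorphic f -> holomorphic g ->
    N r (fun z => f z * g z) <= N r f * N r g;
  family_cvg : forall f, holomorphic f -> N r f @[r --> 0^'+] --> cmod (f z0);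
  family_split : forall r f, 0 < r < 1 -> holomorphic f ->
    N r f = cmod (f z0) + N r (fun z => f z - f z0)
}.

Definition domain (R : realType) (G : set (C R)) : Prop :=
  [/\ open G, connected G & G !=set0].

(* [Rcomplex R] is R[i] as a real vector space: convexity is over R. *)
Definition convex_hull (R : realType) (G : set (C R)) : set (C R) :=
  smallest (fun K : set (Rcomplex R) => convex_set K) G.

Definition boundary (R : realType) (A : set (C R)) : set (C R) :=
  closure A `\` interior A.

(* The distance to the empty set is +oo. *)
Definition dist (R : realType) (z : C R) (A : set (C R)) : \bar R :=
  ereal_inf [set (cmod (z - w))%:E | w in A].

Definition is_disk (R : realType) (U : set (C R)) : Prop :=
  exists (c : C R) (rho : R), 0 < rho /\ U = [set z | cmod (z - c) < rho].

Definition is_half_plane (R : realType) (P : set (C R)) : Prop :=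
  exists (a : C R) (b : R), a != 0 /\ P = [set z | b < complex.Re (a * z)].

Definition point_of_convexity (R : realType) (G : set (C R)) (p : C R) : Prop :=
  boundary G p /\ boundary (convex_hull G) p.

Definition regular_point_of_convexity (R : realType) (G : set (C R))
    (p : C R) : Prop :=
  point_of_convexity G p /\
  exists U, [/\ is_disk U, U `<=` G & boundary U p].

Definition bohr_admissible (R : realType) (n : nat) (M : complexManifold R n)
    (z0 : M) (N : R -> (M -> C R) -> R) (G : set (C R)) (r : R) : Prop :=
  forall f : M -> C R, holomorphic f -> range f `<=` G ->
    ((N r (fun z => f z - f z0))%:E < dist (f z0) (boundary (convex_hull G)))%E.

(* The "largest r >= 0" is a supremum, which need not be attained: for the
   classical norms sum |a_k| r^k on the unit disk and G a half-plane, the strict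
   inequality fails at the Bohr radius 1/3 itself.  The value 0 stands for the
   case where no r in (0, 1) is admissible. *)
Definition bohr_radius (R : realType) (n : nat) (M : complexManifold R n)
    (z0 : M) (N : R -> (M -> C R) -> R) (G : set (C R)) : R :=
  sup ([set 0] `|` [set r | 0 < r < 1 /\ bohr_admissible z0 N G r]).

(* Main.v *)
Require Import Defs.
From HB Require Import structures.
From mathcomp Require Import all_boot all_order all_algebra.
From mathcomp Require Import complex.
From mathcomp Require Import all_classical all_reals all_analysis.
From mathcomp Require Import ring lra.
Import Order.TTheory GRing.Theory Num.Theory.
Import numFieldNormedType.Exports.

Set Implicit Arguments.
Unset Strict Implicit.
Unset Printing Implicit Defensive.

Local Open Scope classical_set_scope.
Local Open Scope ring_scope.

(** Lower bound.  Let [f] map [M] into [G] and put [w = f z0], a point of the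
    convex set [H = convex_hull G].  Among the points outside the interior of
    [H] let [p] be one nearest to [w].  The open disk about [w] through [p] lies
    in [H], so a point of [G] on the far side of the line through [p]
    orthogonal to [w - p] would, together with that disk, put [p] in the
    interior of [H].  Hence [G] lies in the half-plane [P] bounded by that line
    ([supporting_half_plane]), and [w] is at least as far from the boundary of
    [H] as from that of [P].  So an [r] that is admissible for all half-planes
    is admissible for [G].  By the monotonicity of the semi-norms in [r] every
    [0 < r < beta] is of this kind, because [beta] is the radius of every
    half-plane.

    Upper bound.  Let [U] be a disk in [G] that touches the boundary of [H] at
    [p], and let [f] map [M] into [U].  Rotating [f] about the centre of [U]
    changes neither the semi-norm of [f - f z0] nor the distance from [f z0] to
    the boundary of [U], so [f z0] may be assumed to lie on the radius that ends
    at [p].  Then [p] is the boundary point of [U] nearest to [f z0], and since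
    [p] is also on the boundary of [H], the strict inequality for [G] implies
    the one for [U] ([disk_admissible]).  Thus every [r] admissible for [G] is
    admissible for [U], hence at most [beta]. *)

(** * The modulus and the topology of the complex plane *)

Lemma cmod_ge0 {R : realType} (z : C R) : 0 <= cmod z.
Proof. by case: z => a b /=; exact: sqrtr_ge0. Qed.

Lemma cmod_sqr {R : realType} (z : C R) :
  cmod z ^+ 2 = complex.Re z ^+ 2 + complex.Im z ^+ 2.
Proof. by case: z => a b /=; rewrite sqr_sqrtr // addr_ge0 ?sqr_ge0. Qed.

Lemma ler_cmodD {R : realType} (x y : C R) : cmod (x + y) <= cmod x + cmod y.
Proof. exact: le_normcD. Qed.

Lemma cmod_distC {R : realType} (x y : C R) : cmod (x - y) = cmod (y - x).
Proof. by rewrite -opprB; exact: normcN. Qed.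

Lemma cmod_real {R : realType} (t : R) : cmod (t%:C)%C = `|t|.
Proof. by rewrite /= expr0n /= addr0 sqrtr_sqr. Qed.

Lemma cmod_eq0 {R : realType} (z : C R) : (cmod z == 0) = (z == 0).
Proof.
apply/eqP/eqP => [|->]; [exact: ComplexField.Normc.eq0_normc
                        | exact: ComplexField.Normc.normc0].
Qed.

(** The norm of [C R] takes values in [R[i]], and so do the radii of its balls.
    A positive element of [R[i]] is a positive real, so the usual disks of real
    radius generate the same neighbourhoods. *)
Lemma nbhs_cmodP {R : realType} (z : C R) (A : set (C R)) :
  nbhs z A <-> exists2 e : R, 0 < e & forall y, cmod (y - z) < e -> A y.
Proof.
split=> [/nbhs_ballP[[e e']]|[e e0 eA]].
  rewrite /= ltcE /= => /andP[/eqP e'0 e0]; rewrite -ball_normE /= => eA.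
  exists e => // y yz; apply: eA => /=.
  rewrite e'0 distrC -[`|_|]/((cmod (y - z))%:C)%C -[(e +i* 0)%C]/(e%:C)%C.
  by rewrite ltcR.
apply/(nbhs_ballP z A); exists (e%:C)%C => [|y]; first by rewrite /= ltcR.
rewrite -ball_normE /= distrC -[`|_|]/((cmod (y - z))%:C)%C ltcR.
exact: eA.
Qed.

Lemma closure_cmod {R : realType} (z : C R) (A : set (C R)) (e : R) :
  closure A z -> 0 < e -> exists2 y, A y & cmod (y - z) < e.
Proof.
move=> Az e0.
have /Az[y [Ay yz]] : nbhs z [set y : C R | cmod (y - z) < e].
  by apply/nbhs_cmodP; exists e.
by exists y.
Qed.

(** The minimum is taken over the part of [F] in a square about [w], which is
    compact: the plane is parametrized by [R * R], in which that square is a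
    product of two segments. *)
Lemma exists_nearest {R : realType} (F : set (C R)) (w : C R) :
  closed F -> F !=set0 ->
  exists2 p, F p & forall q, F q -> cmod (w - p) <= cmod (w - q).
Proof.
move=> cF [q0 Fq0].
pose h (v : R * R) : C R := (v.1 +i* v.2)%C.
have ler_cmod (x y : R) : cmod (x +i* y)%C <= `|x| + `|y|.
  rewrite -(@ler_pXn2r _ 2) ?nnegrE ?addr_ge0 ?cmod_ge0 // cmod_sqr /=.
  rewrite sqrrD !real_normK ?num_real //.
  by rewrite -addrA lerD2l -[X in X <= _]add0r lerD2r mulrn_wge0 // mulr_ge0.
have hc : continuous h.
  move=> v A /nbhs_cmodP[e e0 eA].
  have /= : nbhs v (ball v (e / 2)) by apply: nbhsx_ballx; rewrite divr_gt0.
  apply: filterS => u [/= u1 u2]; apply: eA.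
  rewrite -[h u - h v]/((u.1 - v.1) +i* (u.2 - v.2))%C.
  apply: le_lt_trans (ler_cmod _ _) _.
  rewrite [ltRHS](splitr e) [in ltLHS]distrC [`|u.2 - _|]distrC.
  exact: ltrD.
have dc : continuous (fun v : R * R => cmod (w - h v)).
  move=> v A /nbhs_ballP[/= e e0 eA].
  have hv : nbhs v (h @^-1` [set y | cmod (y - h v) < e]).
    by apply: hc; apply/nbhs_cmodP; exists e.
  apply: filterS hv => u hu; have {}hu : cmod (h u - h v) < e := hu.
  apply: eA; rewrite -ball_normE /=.
  rewrite ltr_distl; have := ler_cmodD (w - h u) (h u - h v).
  have := ler_cmodD (w - h v) (h v - h u).
  rewrite !addrA !subrK [cmod (h v - _)]cmod_distC; lra.
pose b := cmod (w - q0).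
(* any point of [F] at least as near to [w] as [q0] is in this square *)
pose box := `[complex.Re w - b, complex.Re w + b]%classic `*`
            `[complex.Im w - b, complex.Im w + b]%classic.
have Re_le (z : C R) : `|complex.Re z| <= cmod z.
  rewrite -(@ler_pXn2r _ 2) ?nnegrE ?cmod_ge0 // cmod_sqr.
  rewrite real_normK ?num_real //.
  by rewrite lerDl sqr_ge0.
have Im_le (z : C R) : `|complex.Im z| <= cmod z.
  rewrite -(@ler_pXn2r _ 2) ?nnegrE ?cmod_ge0 // cmod_sqr.
  rewrite real_normK ?num_real //.
  by rewrite lerDr sqr_ge0.
have in_box (q : C R) : cmod (w - q) <= b -> box (complex.Re q, complex.Im q).
  move=> qb; have := le_trans (Re_le (w - q)) qb.
  have := le_trans (Im_le (w - q)) qb.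
  have -> : complex.Re (w - q) = complex.Re w - complex.Re q.
    by case: (w) (q) => ? ? [].
  have -> : complex.Im (w - q) = complex.Im w - complex.Im q.
    by case: (w) (q) => ? ? [].
  by rewrite !ler_norml /box /= !in_itv /= => /andP[? ?] /andP[? ?]; split; lra.
have hK (q : C R) : h (complex.Re q, complex.Im q) = q by case: q.
have [|||v] := @compact_EVT_min _ R (fun v : R * R => cmod (w - h v))
                                (box `&` h @^-1` F).
- exists (complex.Re q0, complex.Im q0).
  by split; [exact: in_box | rewrite /= hK].
- apply: compact_closedI; first by apply: compact_setX; exact: segment_compact.
  by apply: closed_comp => // v _; exact: hc.
- by apply: continuous_subspaceT.
rewrite inE => -[_ Fv] vmin; exists (h v) => // q Fq.
have [qb|/ltW bq] := leP (cmod (w - q)) b.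
  rewrite -[q in leRHS]hK; apply: vmin; rewrite inE; split; first exact: in_box.
  by rewrite /= hK.
apply: le_trans bq; rewrite /b -[q0 in leRHS]hK; apply: vmin; rewrite inE.
by split; [exact: in_box | rewrite /= hK].
Qed.

(** * Convex sets in the plane *)

Lemma convex_complexP {R : realType} (K : set (C R)) :
  convex_set (K : set (Rcomplex R)) <->
  forall (x y : C R) (t : R), 0 <= t <= 1 -> K x -> K y ->
    K (t%:C%C * x + (1 - t)%:C%C * y).
Proof.
have scaleE (t : R) (x : Rcomplex R) : t *: x = t%:C%C * x.
  by case: x => a b; simpc.
split=> [cK x y t t01 Kx Ky|cK x y t].
  have t01' : Itv.spec (@Itv.num_sem R) (Itv.Real `[0%Z, 1%Z]) t.
    by rewrite /= /Itv.num_sem /= in_itv /= t01 realE; case/andP: t01 => ->.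
  have := cK x y (Itv.mk t01'); rewrite !inE => /(_ Kx Ky).
  by rewrite /conv /= !scaleE.
rewrite !inE /conv /= !scaleE => Kx Ky; apply: cK => //.
by rewrite ge0 le1.
Qed.

(** Continue the segment from [z] to [p] slightly beyond [p].  Since it makes
    an acute angle with [w - p] at [p], it enters the disk about [w] through
    [p], at [q] say; then [p] is strictly between [z] and the interior point
    [q] of [K]. *)
Lemma interior_convex_opposite {R : realType} (K : set (C R)) (w p z : C R) :
  convex_set (K : set (Rcomplex R)) ->
  (forall y, cmod (w - y) < cmod (w - p) -> K y) -> K z ->
  complex.Re ((w - p)^* * (z - p))%C < 0 -> interior K p.
Proof.
move=> /convex_complexP cK wK Kz zp.
pose A : R := complex.Re ((w - p)^* * (z - p))%C.
have {}zp : A < 0 := zp.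
pose Z : R := cmod (z - p) ^+ 2.
have Z0 : 0 <= Z by exact: sqr_ge0.
(* [q = p + s (p - z)] satisfies
   [|w - q|^2 = |w - p|^2 + 2 s A + s^2 Z], and this [s] makes
   [2 s A + s^2 Z = s (A - s)] negative *)
pose s : R := - A / (Z + 1).
have s0 : 0 < s by rewrite divr_gt0 //; lra.
have sE : s * Z + s = - A by rewrite /s; field; lra.
have qd : cmod (w - ((1 + s)%:C%C * p - s%:C%C * z)) < cmod (w - p).
  rewrite -(@ltr_pXn2r _ 2) ?nnegrE ?cmod_ge0 //.
  have -> : cmod (w - ((1 + s)%:C%C * p - s%:C%C * z)) ^+ 2 =
            cmod (w - p) ^+ 2 + 2 * s * A + s ^+ 2 * Z.
    rewrite /Z /A !cmod_sqr; case: (w) (p) (z) => [w1 w2] [p1 p2] [z1 z2].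
    by simpc => /=; ring.
  rewrite -addrA gtrDl.
  have -> : 2 * s * A + s ^+ 2 * Z = s * (A + (A + (s * Z + s)) - s) by ring.
  rewrite sE subrr addr0 pmulr_rlt0 //.
  have : A - s < 0 by lra.
  exact.
set q := (1 + s)%:C%C * p - s%:C%C * z in qd.
(* the homothety of centre [z] that sends [p] to [q] has ratio [1 + s]; it
   moves a small disk about [p] into the disk about [w] *)
have s1 : 0 < 1 + s by lra.
apply/nbhs_cmodP; exists ((cmod (w - p) - cmod (w - q)) / (1 + s)).
  by rewrite divr_gt0 ?subr_gt0.
move=> y; rewrite ltr_pdivlMr // => yp.
have -> : y = (s / (1 + s))%:C%C * z +
              (1 - s / (1 + s))%:C%C * ((1 + s)%:C%C * y - s%:C%C * z).
  case: (y) (z) => [y1 y2] [z1 z2]; simpc.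
  by congr (_ +i* _)%C; field; rewrite gt_eqF.
apply: (cK z ((1 + s)%:C%C * y - s%:C%C * z) (s / (1 + s))) => //.
  by rewrite divr_ge0 ?ler_pdivrMr //=; lra.
apply: wK.
have -> : w - ((1 + s)%:C%C * y - s%:C%C * z) =
          (w - q) + (1 + s)%:C%C * (p - y).
  by rewrite /q; ring.
apply: le_lt_trans (ler_cmodD _ _) _.
rewrite ComplexField.Normc.normcM cmod_real cmod_distC ger0_norm; lra.
Qed.

Lemma lt_mean {R : realType} (b x y t : R) :
  0 <= t -> t <= 1 -> b < x -> b < y -> b < t * x + (1 - t) * y.
Proof.
move=> t0 t1 bx yb; have [tp|tn] := ltP 0 t; first by nra.
have -> : t = 0 by apply/eqP; rewrite eq_le t0 andbT.
by rewrite mul0r add0r subr0 mul1r.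
Qed.

Lemma half_plane_convex {R : realType} (P : set (C R)) :
  is_half_plane P -> convex_set (P : set (Rcomplex R)).
Proof.
move=> [a [b [_ ->]]]; apply/convex_complexP => x y t /andP[t0 t1] /=.
have -> : complex.Re (a * (t%:C%C * x + (1 - t)%:C%C * y)) =
          t * complex.Re (a * x) + (1 - t) * complex.Re (a * y).
  by case: a x y => [a1 a2] [x1 x2] [y1 y2]; simpc => /=; ring.
exact: lt_mean.
Qed.

Lemma disk_convex {R : realType} (U : set (C R)) :
  is_disk U -> convex_set (U : set (Rcomplex R)).
Proof.
move=> [c [rho [_ ->]]]; apply/convex_complexP => x y t /andP[t0 t1] /= xc yc.
have -> : t%:C%C * x + (1 - t)%:C%C * y - c =
          t%:C%C * (x - c) + (1 - t)%:C%C * (y - c).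
  by rewrite rmorphB rmorph1; ring.
apply: le_lt_trans (ler_cmodD _ _) _.
rewrite !ComplexField.Normc.normcM !cmod_real !ger0_norm ?subr_ge0 //.
rewrite -ltrN2 opprD -!mulrN; apply: lt_mean; rewrite ?t0 ?ltrN2 //.
Qed.

Lemma convex_hull_id {R : realType} (K : set (C R)) :
  convex_set (K : set (Rcomplex R)) -> convex_hull K = K.
Proof.
move=> cK; apply/seteqP.
by split; [exact: smallest_sub | exact: sub_gen_smallest].
Qed.

Lemma convex_hull_convex {R : realType} (G : set (C R)) :
  convex_set (convex_hull G : set (Rcomplex R)).
Proof.
apply/convex_complexP => x y t t01 Gx Gy K [cK GK].
by move/convex_complexP: (cK); apply => //; [exact: Gx|exact: Gy].
Qed.

Lemma dist_le {R : realType} (z p : C R) (A : set (C R)) :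
  A p -> (dist z A <= (cmod (z - p))%:E)%E.
Proof. by move=> Ap; apply: ereal_inf_lbound; exists p. Qed.

Lemma le_dist {R : realType} (z : C R) (A : set (C R)) (d : R) :
  (forall p, A p -> d <= cmod (z - p)) -> (d%:E <= dist z A)%E.
Proof.
by move=> dA; apply: le_ereal_inf_tmp => _ [p Ap <-]; rewrite lee_fin dA.
Qed.

Lemma small_multiple {R : realType} {c e : R} :
  0 <= c -> 0 < e -> exists2 t, 0 < t & t * c < e.
Proof.
move=> c0 e0; exists (e / (c + 1)); first by rewrite divr_gt0 //; lra.
rewrite mulrAC ltr_pdivrMr ?ltr_pM2l //; lra.
Qed.

(** The half-plane depends on [w]: it is the one supporting the hull at a point
    nearest to [w], so that the distances from [w] to the two boundaries can be
    compared. *)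
Lemma supporting_half_plane {R : realType} (G : set (C R)) (w : C R) :
  open G -> convex_hull G <> setT -> G w ->
  exists P, [/\ is_half_plane P, G `<=` P &
    (dist w (boundary P) <= dist w (boundary (convex_hull G)))%E].
Proof.
move=> oG nT Gw; set H := convex_hull G in nT *.
have GH : G `<=` H by exact: sub_gen_smallest.
have [||p Hp pmin] := @exists_nearest _ (~` interior H) w.
- exact/open_closedC/open_interior.
- apply/set0P/eqP => /(congr1 setC); rewrite setCK setC0 => iT; apply: nT.
  by apply/seteqP; split=> // x _; apply: interior_subset; rewrite iT.
have wH : interior H w by apply: filterS GH _; exact: oG.
have wp0 : w - p != 0 by apply/eqP => /subr0_eq wp; apply: Hp; rewrite -wp.
have wpN : 0 < cmod (w - p) by rewrite lt0r cmod_eq0 wp0 cmod_ge0.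
have ballH y : cmod (w - y) < cmod (w - p) -> H y.
  move=> yw; apply: interior_subset; apply: contrapT => /pmin.
  by rewrite leNgt yw.
pose a := ((w - p)^*)%C.
have aE (z : C R) :
  complex.Re (a * z) = complex.Re (a * p) + complex.Re (a * (z - p)).
  by case: (a) (z) (p) => [a1 a2] [z1 z2] [p1 p2]; simpc => /=; ring.
have awE (t : R) : complex.Re (a * (t%:C%C * (w - p))) = t * cmod (w - p) ^+ 2.
  by rewrite cmod_sqr /a; case: (w - p) => [u v]; simpc => /=; ring.
pose P := [set z : C R | complex.Re (a * p) < complex.Re (a * z)].
exists P; split.
- exists a, (complex.Re (a * p)); split; last exact: erefl.
  by rewrite /a conjc_eq0.
- move=> z Gz; suff : complex.Re (a * p) < complex.Re (a * z) by [].
  rewrite (aE z) ltrDl ltNge; apply/negP => zp.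
  (* [z] may lie on the line itself; as [G] is open, it can be pushed strictly
     beyond the line without leaving [G] *)
  have /nbhs_cmodP[e e0 eG] : nbhs z G by exact: oG.
  have [t t0 te] := small_multiple (cmod_ge0 (w - p)) e0.
  apply: Hp.
  apply: (@interior_convex_opposite _ H w p (z - t%:C%C * (w - p))) => //.
  + exact: convex_hull_convex.
  + apply: GH; apply: eG; rewrite addrC addKr normcN.
    by rewrite ComplexField.Normc.normcM cmod_real gtr0_norm.
  + have -> : complex.Re (a * (z - t%:C%C * (w - p) - p)) =
      complex.Re (a * (z - p)) - complex.Re (a * (t%:C%C * (w - p))).
      case: (a) (z) (p) (w) => [a1 a2] [z1 z2] [p1 p2] [w1 w2].
      by simpc => /=; ring.
    by rewrite awE subr_lt0 (le_lt_trans zp) // mulr_gt0 ?exprn_gt0.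
- apply: (@le_trans _ _ (cmod (w - p))%:E); last first.
    by apply: le_dist => q [_ qH]; exact: pmin.
  apply: dist_le; split.
    move=> B /nbhs_cmodP[e e0 eB].
    have [t t0 te] := small_multiple (cmod_ge0 (w - p)) e0.
    exists (p + t%:C%C * (w - p)); split.
      suff : complex.Re (a * p) < complex.Re (a * (p + t%:C%C * (w - p))) by [].
      rewrite (aE (p + t%:C%C * (w - p))) ltrDl [p + _]addrC addrK awE.
      by rewrite mulr_gt0 ?exprn_gt0.
    apply: eB; rewrite addrC addKr ComplexField.Normc.normcM cmod_real.
    by rewrite gtr0_norm.
  by move=> /interior_subset; rewrite /P /= ltxx.
Qed.

Lemma disk_boundary {R : realType} (c : C R) (rho : R) (p : C R) :
  boundary [set z | cmod (z - c) < rho] p -> cmod (p - c) = rho.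
Proof.
move=> [clp ip]; apply/eqP; rewrite eq_le; apply/andP; split.
  rewrite leNgt; apply/negP => pc.
  have [y /= yc yp] : exists2 y, cmod (y - c) < rho &
      cmod (y - p) < cmod (p - c) - rho.
    by apply: closure_cmod clp _; rewrite subr_gt0.
  have := ler_cmodD (p - y) (y - c).
  by rewrite addrA subrK [cmod (p - y)]cmod_distC; lra.
rewrite leNgt; apply/negP => pc; apply: ip.
apply/nbhs_cmodP; exists (rho - cmod (p - c)); first by rewrite subr_gt0.
move=> y yp /=; have := ler_cmodD (y - p) (p - c).
by rewrite addrA subrK; lra.
Qed.

(** Turns a point about the centre of a disk onto a prescribed radius.  The
    centre itself, [h = 0], has no direction, but there any [a] works. *)
Lemma exists_rotation {R : realType} (h u : C R) : cmod u = 1 ->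
  exists2 a : C R, cmod a = 1 & a * h = u * (cmod h)%:C%C.
Proof.
move=> u1; have [->|h0] := eqVneq h 0.
  exists 1; first exact: ComplexField.Normc.normc1.
  by rewrite ComplexField.Normc.normc0 !mulr0.
have hN0 : cmod h != 0 by rewrite cmod_eq0.
exists (u * (cmod h)%:C%C / h); last by rewrite divfK.
rewrite !ComplexField.Normc.normcM ComplexField.Normc.normcV cmod_real u1 mul1r.
by rewrite ger0_norm ?cmod_ge0 // divff.
Qed.

(** * Admissible radii *)

Lemma sub_holomorphic {R : realType} {n : nat} {M : complexManifold R n}
  (f : M -> C R) (b : C R) : holomorphic f -> holomorphic (fun z => f z - b).
Proof.
move=> hf c ac x cx; apply: (@differentiableB _ _ _ (f \o chart_inv c) (cst b)).
  exact: hf.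
exact: differentiable_cst.
Qed.

Lemma affine_holomorphic {R : realType} {n : nat} {M : complexManifold R n}
  (f : M -> C R) (a b : C R) :
  holomorphic f -> holomorphic (fun z => a * f z + b).
Proof.
move=> hf c ac x cx.
apply: (@differentiableD _ _ _ (a \*: (f \o chart_inv c)) (cst b)).
  by apply: differentiableZ; exact: hf.
exact: differentiable_cst.
Qed.

Section BohrRadius.
Context {R : realType} {n : nat} {M : complexManifold R n} {z0 : M}.
Context {N : R -> (M -> C R) -> R} (hN : bohr_family z0 N).
Implicit Types (G U P : set (C R)) (r s : R).

Lemma bohr_admissible_le G r s : 0 < r -> r <= s -> s < 1 ->
  bohr_admissible z0 N G s -> bohr_admissible z0 N G r.
Proof.
move=> r0 rs s1 As f hf fG; apply: le_lt_trans (As f hf fG).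
rewrite lee_fin; apply: (family_mono hN _ _ rs (sub_holomorphic _ hf)).
  by rewrite r0 (le_lt_trans rs).
by rewrite s1 (lt_le_trans r0).
Qed.

Lemma bohr_radius_ubound G :
  has_ubound ([set 0] `|` [set r | 0 < r < 1 /\ bohr_admissible z0 N G r]).
Proof.
by exists 1 => r [->|[/andP[_ /ltW] //]].
Qed.

Lemma admissible_le_bohr_radius G r :
  0 < r < 1 -> bohr_admissible z0 N G r -> r <= bohr_radius z0 N G.
Proof. by move=> r01 Ar; apply: (ub_le_sup (bohr_radius_ubound G)); right. Qed.

Lemma bohr_radius_ge0 G : 0 <= bohr_radius z0 N G.
Proof. by apply: (ub_le_sup (bohr_radius_ubound G)); left. Qed.

(** Admissibility is inherited by smaller radii, so the supremum bounds an
    interval of admissible values. *)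
Lemma lt_bohr_radius G r : 0 < r -> r < bohr_radius z0 N G ->
  r < 1 /\ bohr_admissible z0 N G r.
Proof.
move=> r0 /sup_gt[|s [->|[/andP[s0 s1] As]] rs]; first by exists 0; left.
  by have := lt_trans r0 rs; rewrite ltxx.
split; first exact: lt_trans s1.
by apply: bohr_admissible_le As => //; exact: ltW.
Qed.

(** Apply the hypothesis to the rotation [g] of [f] about the centre of the disk
    that brings [f z0] onto the radius ending at [p]: the boundary distance of
    [f z0] in the disk then is [|g z0 - p|], which is an upper bound for the
    boundary distance of [g z0] in the hull of [G]. *)
Lemma disk_admissible G U p r :
  0 < r < 1 -> is_disk U -> U `<=` G -> boundary U p ->
  boundary (convex_hull G) p ->
  bohr_admissible z0 N G r -> bohr_admissible z0 N U r.
Proof.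
move=> r01 dU UG Up Gp Ar f hf fU.
rewrite (convex_hull_id (disk_convex dU)).
move: dU => [c [rho [rho0 UE]]]; rewrite {}UE in UG Up fU *.
have pc := disk_boundary Up.
have w_rho : cmod (f z0 - c) < rho by apply: fU; exists z0.
have u1 : cmod ((p - c) / rho%:C%C) = 1.
  rewrite ComplexField.Normc.normcM ComplexField.Normc.normcV cmod_real pc.
  by rewrite gtr0_norm // divff // gt_eqF.
have [a a1 aE] := exists_rotation (f z0 - c) u1.
pose g z := a * f z + (c - a * c).
have gE z : g z - c = a * (f z - c) by rewrite /g; ring.
have hg : holomorphic g by exact: affine_holomorphic.
have gG : range g `<=` G.
  move=> _ [z _ <-]; apply: UG => /=.
  rewrite gE ComplexField.Normc.normcM a1 mul1r.
  by apply: fU; exists z.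
have NE : N r (fun z => g z - g z0) = N r (fun z => f z - f z0).
  have -> : (fun z => g z - g z0) = (fun z => a * (f z - f z0)).
    by apply/funext => z; rewrite /g; ring.
  have sN := family_seminorm hN r01.
  by rewrite (seminorm_scale sN a (sub_holomorphic (f z0) hf)) a1 mul1r.
have gp : cmod (g z0 - p) = rho - cmod (f z0 - c).
  have -> : g z0 - p = ((cmod (f z0 - c) - rho) / rho)%:C%C * (p - c).
    have -> : g z0 - p = (g z0 - c) - (p - c) by ring.
    rewrite gE aE rmorphM rmorphB fmorphV; field.
    by rewrite fmorph_eq0 gt_eqF.
  rewrite ComplexField.Normc.normcM cmod_real pc normrM normfV (gtr0_norm rho0).
  by rewrite divfK ?gt_eqF // distrC gtr0_norm // subr_gt0.
have := Ar g hg gG; rewrite NE => /lt_le_trans/(_ (dist_le _ Gp)).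
rewrite gp => /lt_le_trans; apply; apply: le_dist => q /disk_boundary qc.
have := ler_cmodD (q - f z0) (f z0 - c).
by rewrite addrA subrK qc cmod_distC; lra.
Qed.

(** The half-plane to which the hypothesis is applied varies with the function,
    through its value at [z0]. *)
Lemma admissible_half_planes G r : open G -> convex_hull G <> setT ->
  (forall P, is_half_plane P -> bohr_admissible z0 N P r) ->
  bohr_admissible z0 N G r.
Proof.
move=> oG nT AP f hf fG.
have [|P [hP GP distP]] := @supporting_half_plane _ G (f z0) oG nT.
  by apply: fG; exists z0.
apply: lt_le_trans distP.
rewrite -[in boundary P](convex_hull_id (half_plane_convex hP)).
by apply: AP => //; exact: subset_trans GP.
Qed.

End BohrRadius.

Theorem theorem3p1 (R : realType) (n : nat) (M : complexManifold R n) (z0 : M)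
    (N : R -> (M -> C R) -> R) (hN : bohr_family z0 N)
    (beta : R)
    (beta_disk : forall U : set (C R), is_disk U -> bohr_radius z0 N U = beta)
    (beta_half_plane : forall P : set (C R), is_half_plane P ->
      bohr_radius z0 N P = beta)
    (G : set (C R)) (hG : domain G) :
  (convex_hull G <> setT -> beta <= bohr_radius z0 N G) /\
  ((exists p : C R, regular_point_of_convexity G p) ->
    bohr_radius z0 N G = beta).
Proof.
have [oG _ _] := hG.
have ge_beta : convex_hull G <> setT -> beta <= bohr_radius z0 N G.
  move=> nT; rewrite leNgt; apply/negP => /midf_lt[].
  (* strictly below [beta], hence admissible for all half-planes at once *)
  set r := (_ / 2) => rl rg.
  have r0 : 0 < r by apply: le_lt_trans rl; exact: bohr_radius_ge0.
  have AP P : is_half_plane P -> r < 1 /\ bohr_admissible z0 N P r.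
    by move=> hP; apply: (lt_bohr_radius hN r0); rewrite (beta_half_plane P hP).
  (* some half-plane is needed to see that [r < 1] *)
  have [r1 _] :
      r < 1 /\ bohr_admissible z0 N [set z | 0 < complex.Re (1 * z)] r.
    by apply: AP; exists 1, 0; rewrite oner_neq0.
  have : r <= bohr_radius z0 N G.
    apply: admissible_le_bohr_radius; first by rewrite r0.
    by apply: admissible_half_planes => // P /AP[].
  by rewrite leNgt rl.
split=> // -[p [[_ Hp] [U [dU UG Up]]]].
apply/eqP; rewrite eq_le ge_beta ?andbT; last first.
  by move=> HT; case: Hp; rewrite HT interiorT => _; exact.
apply: ge_sup; first by exists 0; left.
rewrite -(beta_disk U dU) => r [->|[r01 Ar]]; first exact: bohr_radius_ge0.
exact: admissible_le_bohr_radius r01 (disk_admissible hN r01 dU UG Up Hp Ar).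
Qed.
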